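(* Let $\Gamma$ and $\Delta$ be connected graphs, and let $y\in V(\Delta)$. Suppose that $\Lambda$ is one of the following graphs: the Cartesian product $\Gamma\,\square\,\Delta$, the strong product $\Gamma\boxtimes\Delta$, the lexicographic product $\Gamma\times\Delta$, or the rooted product $\Gamma\circ_y\Delta$. Then \[\mathsf{wCop}(\Gamma)\le\mathsf{wCop}(\Lambda)\quad\text{and}\quad\mathsf{sCop}(\Gamma)\le\mathsf{sCop}(\Lambda).\]
   Context: Graphs are undirected, without double edges and without loops. For a connected graph $\Gamma$, $\mathsf{dist}$ is the path distance on $V(\Gamma)$. Products. All have vertex set $V(\Gamma)\times V(\Delta)$; let $(u,v)\ne(u',v')$. In $\Gamma\,\square\,\Delta$ they are adjacent iff ($u=u'$ and $v,v'$ adjacent in $\Delta$) or ($v=v'$ and $u,u'$ adjacent in $\Gamma$). In $\Gamma\boxtimes\Delta$ they are adjacent iff ($u=u'$ or $u,u'$ adjacent) and ($v=v'$ or $v,v'$ adjacent). In the lexicographic product $\Gamma\times\Delta$ they are adjacent iff $u,u'$ are adjacent in $\Gamma$, or $u=u'$ and $v,v'$ are adjacent in $\Delta$. In the rooted product $\Gamma\circ_y\Delta$ over the vertex $y$ of $\Delta$ they are adjacent iff ($u=u'$ and $v,v'$ adjacent in $\Delta$) or ($v=v'=y$ and $u,u'$ adjacent in $\Gamma$). Game. The cops and robber game on a connected graph $\Gamma$ has parameters: number of cops $n$, cop speed $\sigma$, cop reach $\rho$, robber speed $\psi$, a vertex $v$, and a positive integer $R$. It is a perfect information game. First the $n$ cops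 choose initial vertices $c^1_0,\dots,c^n_0$; then, knowing these, the robber chooses an initial vertex $r_0$. In stage $k\ge 1$ each cop moves from $c^i_{k-1}$ to a vertex $c^i_k$ with $\mathsf{dist}(c^i_{k-1},c^i_k)\le\sigma$. The robber is captured during stage $k$ if $\mathsf{dist}(r_{k-1},c^i_k)\le\rho$ for some $i$. If not captured, the robber moves from $r_{k-1}$ to a vertex $r_k$ such that there is a path from $r_{k-1}$ to $r_k$ of length at most $\psi$ all of whose vertices are at distance larger than $\rho$ from every $c^i_k$. The cops win (protect the $R$-ball centered at $v$) if the robber is captured at some stage or there is $N>0$ such that $\mathsf{dist}(v,r_k)>R$ for all $k\ge N$. $\Gamma$ is $\mathsf{CopWin}(n,\sigma,\rho,\psi,R)$ if for every vertex $v$ of $\Gamma$ the $n$ cops have a winning strategy in the game with parameters $n,\sigma,\rho,\psi,v,R$. $\Gamma$ is $n$-weak cop win if $\exists\,\sigma\in\mathbb{Z}_{>0}\ \exists\,\rho\in\mathbb{Z}_{\ge0}\ \forall\,\psi,R\in\mathbb{Z}_{>0}$: $\Gamma$ is $\mathsf{CopWin}(n,\sigma,\rho,\psi,R)$. $\Gamma$ is $n$-strong cop win if $\exists\,\sigma\in\mathbb{Z}_{>0}\ \forall\,\psi\in\mathbb{Z}_{>0}\ \exists\,\rho\in\mathbb{Z}_{\ge0}\ \forall\,R\in\mathbb{Z}_{>0}$: $\Gamma$ is $\mathsf{CopWin}(n,\sigma,\rho,\psi,R)$. The weak cop number $\mathsf{wCop}(\Gamma)$ (resp. strong cop number $\mathsf{sCop}(\Gamma)$)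 in $\mathbb{Z}_{>0}\cup\{\infty\}$ is the smallest positive integer $n$ such that $\Gamma$ is $n$-weak (resp. $n$-strong) cop win, and $\infty$ if there is none. *)

(* Defs.v *)
From mathcomp Require Import all_boot boolp.

Set Implicit Arguments.
Unset Strict Implicit.
Unset Printing Implicit Defensive.

(* Extended natural numbers; [None] is infinity. *)
Definition enat := option nat.

Definition ele (a b : enat) : bool :=
  match a, b with
  | _, None => true
  | None, Some _ => false
  | Some m, Some n => m <= n
  end.

Definition elt (a b : enat) : bool := ~~ ele b a.

Definition least (P : nat -> Prop) : enat :=
  match pselect (exists n, `[< P n >]) with
  | left exP => Some (ex_minn exP)
  | right _ => None
  end.

(* Graphs may be infinite, even uncountable or not locally finite. *)
Record graph := Graph {
  vertex :> Type;
  adj : vertex -> vertex -> Prop;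
  adj_sym : forall u v, adj u v -> adj v u;
  adj_irrefl : forall u, ~ adj u u
}.

(* [u :: s] is the sequence of vertices of the path, so its length is
   [size s]; repeated vertices are allowed. *)
Definition is_path (G : graph) (u w : G) (s : seq G) : Prop :=
  path (fun x y : G => `[< adj x y >]) u s /\ last u s = w.

Definition connected (G : graph) : Prop :=
  forall u w : G, exists s, is_path u w s.

Definition dist (G : graph) (u w : G) : enat :=
  least (fun l => exists2 s, is_path u w s & size s = l).

Section Products.

Variables G D : graph.

Definition cartesian_adj (a b : G * D) : Prop :=
  (a.1 = b.1 /\ adj a.2 b.2) \/ (a.2 = b.2 /\ adj a.1 b.1).

Definition strong_adj (a b : G * D) : Prop :=
  [/\ a <> b, a.1 = b.1 \/ adj a.1 b.1 & a.2 = b.2 \/ adj a.2 b.2].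

Definition lexicographic_adj (a b : G * D) : Prop :=
  adj a.1 b.1 \/ (a.1 = b.1 /\ adj a.2 b.2).

Definition rooted_adj (y : D) (a b : G * D) : Prop :=
  (a.1 = b.1 /\ adj a.2 b.2) \/ [/\ a.2 = y, b.2 = y & adj a.1 b.1].

Lemma cartesian_sym a b : cartesian_adj a b -> cartesian_adj b a.
Proof. by case=> -[/esym ? /adj_sym ?]; [left | right]. Qed.

Lemma cartesian_irrefl a : ~ cartesian_adj a a.
Proof. by case=> -[_ /adj_irrefl]. Qed.

Lemma strong_sym a b : strong_adj a b -> strong_adj b a.
Proof.
case=> neq h1 h2; split; first by move=> /esym.
- by case: h1 => [/esym|/adj_sym]; [left | right].
- by case: h2 => [/esym|/adj_sym]; [left | right].
Qed.

Lemma strong_irrefl a : ~ strong_adj a a.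
Proof. by case. Qed.

Lemma lexicographic_sym a b : lexicographic_adj a b -> lexicographic_adj b a.
Proof. by case=> [/adj_sym ?|[/esym ? /adj_sym ?]]; [left | right]. Qed.

Lemma lexicographic_irrefl a : ~ lexicographic_adj a a.
Proof. by case=> [/adj_irrefl|[_ /adj_irrefl]]. Qed.

Lemma rooted_sym y a b : rooted_adj y a b -> rooted_adj y b a.
Proof. by case=> [[/esym ? /adj_sym ?]|[? ? /adj_sym ?]]; [left | right]. Qed.

Lemma rooted_irrefl y a : ~ rooted_adj y a a.
Proof. by case=> [[_ /adj_irrefl]|[_ _ /adj_irrefl]]. Qed.

Definition cartesian_product : graph :=
  Graph cartesian_sym cartesian_irrefl.

Definition strong_product : graph :=
  Graph strong_sym strong_irrefl.

Definition lexicographic_product : graph :=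
  Graph lexicographic_sym lexicographic_irrefl.

Definition rooted_product (y : D) : graph :=
  Graph (@rooted_sym y) (@rooted_irrefl y).

End Products.

Section Game.

Variables (G : graph) (n speed reach rspeed : nat).

Definition cops := 'I_n -> G.

(* A deterministic perfect-information strategy: the initial positions, and
   the next positions as a function of the nonempty list
   [:: (c_0, r_0); ...; (c_k, r_k)] of all positions so far. *)
Record strategy := Strategy {
  start : cops;
  next : seq (cops * G) -> cops
}.

Definition cop_move (c c' : cops) : Prop :=
  forall i, ele (dist (c i) (c' i)) (Some speed).

(* Requiring legality after unreachable histories too is no restriction: the
   cops may stay put there. *)
Definition legal (S : strategy) : Prop :=
  forall h c r, cop_move c (next S (rcons h (c, r))).

Definition caught (c : cops) (r : G) : Prop :=
  exists i, ele (dist r (c i)) (Some reach).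

Definition robber_move (c : cops) (r r' : G) : Prop :=
  exists s, [/\ is_path r r' s, size s <= rspeed &
    all (fun x => `[< forall i, elt (Some reach) (dist x (c i)) >]) (r :: s)].

(* A play is given by infinite sequences [c] and [r]; if the robber is
   captured, the positions after that stage are irrelevant. *)
Definition captured_during (c : nat -> cops) (r : nat -> G) (k : nat) : Prop :=
  0 < k /\ caught (c k) (r k.-1).

Definition cops_follow (S : strategy) (c : nat -> cops) (r : nat -> G) : Prop :=
  c 0 = start S /\
  forall k, c k.+1 = next S [seq (c j, r j) | j <- iota 0 k.+1].

Definition robber_legal (c : nat -> cops) (r : nat -> G) : Prop :=
  forall k, (forall j, j <= k.+1 -> ~ captured_during c r j) ->
    robber_move (c k.+1) (r k) (r k.+1).

Definition cops_win (v : G) (R : nat) (c : nat -> cops) (r : nat -> G) : Prop :=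
  (exists k, captured_during c r k) \/
  (exists2 N, 0 < N & forall k, N <= k -> elt (Some R) (dist v (r k))).

Definition winning (v : G) (R : nat) (S : strategy) : Prop :=
  forall c r, cops_follow S c r -> robber_legal c r -> cops_win v R c r.

Definition CopWin (R : nat) : Prop :=
  forall v : G, exists S : strategy, legal S /\ winning v R S.

End Game.

Definition weak_cop_win (G : graph) (n : nat) : Prop :=
  exists2 speed, 0 < speed & exists reach, forall rspeed R,
    0 < rspeed -> 0 < R -> CopWin G n speed reach rspeed R.

Definition strong_cop_win (G : graph) (n : nat) : Prop :=
  exists2 speed, 0 < speed & forall rspeed, 0 < rspeed ->
    exists reach, forall R, 0 < R -> CopWin G n speed reach rspeed R.

Definition wCop (G : graph) : enat :=
  least (fun n => 0 < n /\ weak_cop_win G n).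

Definition sCop (G : graph) : enat :=
  least (fun n => 0 < n /\ strong_cop_win G n).

(* Main.v *)
Require Import Defs.
From mathcomp Require Import all_boot boolp.

(** Each of the four products contains the copy [Gamma * {y}] of [Gamma], and
    the first projection retracts the product onto it. The inclusion
    [u |-> (u, y)] preserves adjacency and the projection maps an edge to an
    edge or to a vertex, so neither map increases distances. These are the only
    facts needed, and the result holds for every graph [G] that is a retract of
    a graph [H] in this sense, with the same parameters on both sides.

    The cops of [G] copy a game in [H]: the robber of [G] is seen in [H] through
    the inclusion, the cops of [H] answer with their winning strategy, and the
    cops of [G] stand at the projections of the cops of [H]. As the
    projection does not increase distances, the cops of [G] respect their speed,
    they are at least as close to the robber as the cops of [H] (so a path that
    avoids them in [G] is included into a path that avoids the cops in [H]), and
    a capture in [H] is a capture in [G]. As the inclusion does not increase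
    distances, a robber who finally leaves the [R]-ball in [H] has left the
    [R]-ball in [G]. Thus [CopWin] passes from [H] to [G] ([retract_CopWin]),
    and so do the two properties of which the cop numbers are the least
    witnesses. *)

Set Implicit Arguments.
Unset Strict Implicit.
Unset Printing Implicit Defensive.

Lemma least_in (P : nat -> Prop) m : least P = Some m -> P m.
Proof.
rewrite /least; case: pselect => // exP [<-].
by case: ex_minnP => k /asboolP.
Qed.

Lemma least_le (P : nat -> Prop) m : P m -> ele (least P) (Some m).
Proof.
move=> Pm; rewrite /least; case: pselect => [exP|[]]; last first.
  by exists m; apply/asboolP.
by case: ex_minnP => k _; apply; apply/asboolP.
Qed.

Lemma least_mono (P Q : nat -> Prop) :
  (forall m, Q m -> P m) -> ele (least P) (least Q).
Proof.
move=> QP; case eqQ: (least Q) => [m|]; last by case: (least P).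
exact: least_le (QP _ (least_in eqQ)).
Qed.

Lemma dist_leP (G : graph) (u w : G) k :
  ele (dist u w) (Some k) <-> exists2 s, is_path u w s & size s <= k.
Proof.
split=> [|[s ps ltsk]].
  case eqd: (dist u w) => [l|] //= lelk.
  by have [s ps sl] := least_in eqd; exists s; rewrite ?sl.
have := least_le (P := fun l => exists2 s, is_path u w s & size s = l)
  (ex_intro2 _ _ s ps erefl).
rewrite -/(dist u w); case: (dist u w) => //= l lels.
exact: leq_trans lels ltsk.
Qed.

Lemma dist_refl_le (G : graph) (u : G) k : ele (dist u u) (Some k).
Proof. by apply/dist_leP; exists [::]. Qed.

(** Edges may be collapsed, as the projection of a product collapses those
    inside a fibre; a path is then mapped to a path that may be shorter. *)
Lemma weak_hom_dist_le (G H : graph) (f : G -> H) :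
  (forall u w, adj u w -> f u = f w \/ adj (f u) (f w)) ->
  forall u w k, ele (dist u w) (Some k) -> ele (dist (f u) (f w)) (Some k).
Proof.
move=> homf u w k /dist_leP[s [ps <-] lesk]; apply/dist_leP.
suff [t pt lets] : exists2 t, is_path (f u) (f (last u s)) t
    & size t <= size s by exists t => //; apply: leq_trans lesk.
elim: s u ps {lesk w} => [|x s IHs] u /=; first by exists [::].
case/andP=> /asboolP/homf fux /IHs[t [pt lt] lets].
case: fux => [->|fux]; first by exists t; last exact: leqW.
by exists (f x :: t); first by split=> //=; apply/andP; split=> //; apply/asboolP.
Qed.

Section Retract.

Variables (G H : graph) (incl : G -> H) (proj : H -> G).
Hypothesis inclK : cancel incl proj.
Hypothesis incl_adj : forall u w, adj u w -> adj (incl u) (incl w).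
Hypothesis proj_adj :
  forall a b, adj a b -> proj a = proj b \/ adj (proj a) (proj b).

Let incl_dist := weak_hom_dist_le (fun u w uw => or_intror (incl_adj uw)).
Let proj_dist := weak_hom_dist_le proj_adj.

Lemma incl_path u w s :
  is_path u w s -> is_path (incl u) (incl w) (map incl s).
Proof.
case=> ps <-; split; last exact: last_map.
rewrite path_map; apply: sub_path ps => x z /asboolP/incl_adj xz.
exact/asboolP.
Qed.

Lemma proj_incl_dist x a k :
  ele (dist (incl x) a) (Some k) -> ele (dist x (proj a)) (Some k).
Proof. by move/proj_dist; rewrite inclK. Qed.

Section Strategy.

Variables (n : nat) (S : strategy H n).

Definition project_cops (C : cops H n) : cops G n := proj \o C.

Definition reply (h : seq (cops H n * H)) : cops H n :=
  if h is [::] then start S else Defs.next S h.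

(** The positions of the cops of [H] cannot be read off from their projections,
    so the game in [H] is replayed from the moves of the robber alone. *)
Definition shadow_history (rs : seq G) : seq (cops H n * H) :=
  foldl (fun h x => rcons h (reply h, incl x)) [::] rs.

(** Legality is required after all histories, also those in which the cops of
    [G] are not the projections of the replayed cops of [H]; after such
    histories the projected answer may be too far, and the cops stay put. *)
Definition shadow_strategy (speed : nat) : strategy G n :=
  Strategy (project_cops (start S)) (fun h =>
    let c := last (project_cops (start S)) (unzip1 h) in
    let c' := project_cops (reply (shadow_history (unzip2 h))) in
    if `[< cop_move speed c c' >] then c' else c).

Lemma shadow_legal speed : legal speed (shadow_strategy speed).
Proof.
move=> h c r /=; rewrite /unzip1 map_rcons last_rcons.
by case: ifP => [/asboolP|_ i] //; apply: dist_refl_le.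
Qed.

Definition shadow_cops (r : nat -> G) (k : nat) : cops H n :=
  reply (shadow_history [seq r j | j <- iota 0 k]).

Lemma shadow_historyE r k :
  shadow_history [seq r j | j <- iota 0 k] =
  [seq (shadow_cops r j, incl (r j)) | j <- iota 0 k].
Proof.
elim: k => // k IHk.
by rewrite -addn1 iotaD add0n !map_cat /= [LHS]foldl_cat /= -cats1 -IHk.
Qed.

Lemma shadow_cops_follow r : cops_follow S (shadow_cops r) (incl \o r).
Proof. by split=> // k; rewrite /shadow_cops shadow_historyE. Qed.

(** In an actual play the fallback is never used: by induction the cops of [G]
    stand at the projections of the replayed cops, whose next move is legal in
    [H] and stays legal under projection. *)
Lemma shadow_cops_proj speed c r :
  legal speed S -> cops_follow (shadow_strategy speed) c r ->
  forall k, c k = project_cops (shadow_cops r k).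
Proof.
move=> legS [c0 cS]; elim=> [|k IHk]; first exact: c0.
rewrite cS /= -[unzip1 _]map_comp -[unzip2 _]map_comp /=.
rewrite (last_map (c : nat -> _) _ 0) (_ : last 0 (iota 1 k) = k); last first.
  by case: k {IHk} => // k; rewrite -[k.+1]addn1 iotaD last_cat /= addn1.
rewrite -/(shadow_cops r k.+1) asboolT // IHk => i.
apply: proj_dist; rewrite (shadow_cops_follow r).2.
by rewrite -[k.+1]addn1 iotaD map_cat cats1; apply: legS.
Qed.

End Strategy.

Lemma retract_CopWin n speed reach rspeed R :
  CopWin H n speed reach rspeed R -> CopWin G n speed reach rspeed R.
Proof.
move=> winH v; have [S [legS winS]] := winH (incl v).
exists (shadow_strategy S speed); split; first exact: shadow_legal.
move=> c r follow robG.
have cE := shadow_cops_proj legS follow.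
(* The robber of [G] may be captured before the copied robber of [H], whose
   later moves could then be illegal, but that already ends the play in [G]. *)
have [|free] := pselect (exists k, captured_during reach c r k); first by left.
have robH : robber_legal reach rspeed (shadow_cops S r) (incl \o r).
  move=> k _; have [|s [ps les away]] := robG k.
    by move=> j _ capt; apply: free; exists j.
  exists (map incl s); split; [exact: incl_path | by rewrite size_map |].
  rewrite -[_ :: _]/(map incl (r k :: s)) all_map; apply: sub_all away => x /asboolP away.
  apply/asboolP => i; move: (away i); rewrite /elt cE.
  by apply: contra => /proj_incl_dist.
case: (winS _ _ (shadow_cops_follow S r) robH) => [[k [k_gt0 [i near]]]|].
  left; exists k; split=> //; exists i; rewrite cE.
  exact: proj_incl_dist.
case=> N N_gt0 out; right; exists N => // k /out.
by rewrite /elt; apply: contra => /incl_dist.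
Qed.

Lemma retract_cop_numbers :
  ele (wCop G) (wCop H) /\ ele (sCop G) (sCop H).
Proof.
split; apply: least_mono => n [n_gt0 [speed speed_gt0]].
  case=> reach win; split=> //; exists speed => //; exists reach => psi R *.
  exact/retract_CopWin/win.
move=> win; split=> //; exists speed => // psi /win[reach {}win].
by exists reach => R /win/retract_CopWin.
Qed.

End Retract.

Theorem corollary6 (Gamma Delta : graph) (y : Delta)
    (Gamma_connected : connected Gamma) (Delta_connected : connected Delta)
    (Lambda : graph)
    (Lambda_product :
       Lambda = cartesian_product Gamma Delta \/
       Lambda = strong_product Gamma Delta \/
       Lambda = lexicographic_product Gamma Delta \/
       Lambda = rooted_product Gamma y) :
  ele (wCop Gamma) (wCop Lambda) /\ ele (sCop Gamma) (sCop Lambda).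
Proof.
have inclK : cancel (fun u : Gamma => (u, y)) fst by [].
case: Lambda_product => [->|[->|[->|->]]].
- apply: (@retract_cop_numbers _ (cartesian_product _ _) _ _ inclK).
    by move=> u w uw; right.
  by move=> a b [[->]|[_]]; [left | right].
- apply: (@retract_cop_numbers _ (strong_product _ _) _ _ inclK).
    move=> u w uw; split; [|by right|by left].
    by case=> uEw; apply: (@adj_irrefl _ u); rewrite {2}uEw.
  by move=> a b [].
- apply: (@retract_cop_numbers _ (lexicographic_product _ _) _ _ inclK).
    by move=> u w uw; left.
  by move=> a b [|[]]; [right | left].
- apply: (@retract_cop_numbers _ (rooted_product _ y) _ _ inclK).
    by move=> u w uw; right.
  by move=> a b [[]|[]]; [left | right].
Qed.
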